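(* (Associative Positivity Criterion) Let $\varphi$ be the given indicator function of a fusion bialgebra $\mathcal B$ with fusion coefficients $\{N_{kj}^i\}_{0\le i,j,k\le n}$. If there exist $i,j,k,\ell$ such that the polynomial $$f(i,j,k,\ell)=\sum_{s=0}^nN_{ij}^sN_{sk}^\ell-\sum_{s=0}^nN_{is}^\ell N_{jk}^s,$$ regarded as a multivariate polynomial in those fusion coefficients that are non-zero according to $\varphi$ (the fusion coefficients that are zero according to $\varphi$ being set to $0$), contains at least one monomial and all of its monomials have the same sign, then $\mathcal B$ is not subfactorizable.
   Context: Fusion bialgebra: a unital $*$-algebra over $\mathbb C$ with a linear basis ($\mathbb R_{\ge0}$-basis) $\{x_0=1,x_1,\dots,x_n\}$ with $x_jx_k=\sum_s\widetilde N_{j,k}^sx_s$, $\widetilde N_{j,k}^s\ge0$, and an involution $*$ on indices with $x_k^*=x_{k^*}$, $\widetilde N_{j,k}^0=\delta_{j,k^*}$. The minimal projections $L_2=\{p_0,\dots,p_n\}$ are positive multiples of $x_0,\dots,x_n$; writing the product as convolution $*$, the fusion coefficients $N_{kj}^i\ge0$ are given by $p_k*p_j=\sum_iN_{kj}^ip_i$. The indicator function is $\varphi:L_2\times L_2\times L_2\to\{0,1\}$ with $\varphi(p_i,p_j,p_k)=0$ iff $N_{kj}^i=0$. A fusion bialgebra is subfactorizable if it can be realized as the 2-box space $\mathcal P_{2,+}$ (abelian) of an irreducible subfactor planar algebra $\mathcal P$, where the $p_i$ are the minimal projections of $\mathcal P_{2,+}$, the product is convolution of 2-boxes, the involution on basis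 elements is $180^\circ$ rotation, and $x_j=\sqrt{\delta/d_j}\,p_j$ with $\delta$ the circle value and $d_j\delta$ the unnormalized Markov trace of $p_j$. *)

(* Defs.v *)
From HB Require Import structures.
From mathcomp Require Import all_boot all_order all_algebra all_field.
From mathcomp Require Import complex.
(* mpoly notations clash with those of MathComp-Analysis *)
From mathcomp Require Import -(notations) mpoly.
From mathcomp Require Import all_classical all_reals all_analysis.
Import Order.TTheory GRing.Theory Num.Theory.
Import numFieldNormedType.Exports.

Set Implicit Arguments.
Unset Strict Implicit.
Unset Printing Implicit Defensive.

Local Open Scope classical_set_scope.
Local Open Scope ring_scope.
Local Open Scope complex_scope.

Record fusion_bialgebra (R : realType) (n : nat) := FusionBialgebra {
  fb_alg :> falgType R[i];
  fb_star : fb_alg -> fb_alg;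
  fb_starK : involutive fb_star;
  fb_starD : forall (a : R[i]) (u v : fb_alg),
    fb_star (a *: u + v) = a^* *: fb_star u + fb_star v;
  fb_starM : forall u v : fb_alg, fb_star (u * v) = fb_star v * fb_star u;
  fb_x : n.+1.-tuple fb_alg;
  fb_x_basis : basis_of fullv fb_x;
  fb_x0 : tnth fb_x ord0 = 1;
  fb_x_ge0 : forall j k s, 0 <= coord fb_x s (tnth fb_x j * tnth fb_x k);
  fb_inv : 'I_n.+1 -> 'I_n.+1;
  fb_invK : involutive fb_inv;
  fb_star_x : forall k, fb_star (tnth fb_x k) = tnth fb_x (fb_inv k);
  fb_x_dual : forall j k,
    coord fb_x ord0 (tnth fb_x j * tnth fb_x k) = (j == fb_inv k)%:R;
  (* p_k is fb_scale k times x_k *)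
  fb_scale : 'I_n.+1 -> R;
  fb_scale_gt0 : forall k, 0 < fb_scale k }.

Section FusionCoefficients.
Variables (R : realType) (n : nat) (B : fusion_bialgebra R n).

Definition fb_p : n.+1.-tuple B :=
  [tuple (fb_scale B k)%:C *: tnth (fb_x B) k | k < n.+1].

(* The second multiplication: the abelian one, of which the p_k are the
   minimal projections. The product of the algebra B is the convolution. *)
Definition fb_dot (u v : B) : B :=
  \sum_(k < n.+1) (coord fb_p k u * coord fb_p k v) *: tnth fb_p k.

(* [fusion_coef k j i] is N_{kj}^i, that is p_k * p_j = \sum_i N_{kj}^i p_i. *)
Definition fusion_coef (k j i : 'I_n.+1) : R[i] :=
  coord fb_p i (tnth fb_p k * tnth fb_p j).

(* phi(p_i, p_j, p_k); note the order of the indices. *)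
Definition indicator (i j k : 'I_n.+1) : bool := fusion_coef k j i != 0.

End FusionCoefficients.

Section AssociativityPolynomial.
Variables (n : nat) (phi : 'I_n.+1 -> 'I_n.+1 -> 'I_n.+1 -> bool).

(* One variable for each triple (k, j, i), standing for N_{kj}^i. *)
Let T := ('I_n.+1 * 'I_n.+1 * 'I_n.+1)%type.

Definition coef_poly := mpoly #|{: T}| int.

Definition coef_var (k j i : 'I_n.+1) : coef_poly :=
  if phi i j k
  then mpolyX int (mnm1 (enum_rank ((k, j, i) : T)))
  else 0.

Definition assoc_poly (i j k l : 'I_n.+1) : coef_poly :=
  \sum_(s < n.+1) coef_var i j s * coef_var s k l
  - \sum_(s < n.+1) coef_var i s l * coef_var j k s.

Definition one_signed (f : coef_poly) : Prop :=
  (forall m, m \in msupp f -> 0 < mcoeff m f) \/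
  (forall m, m \in msupp f -> mcoeff m f < 0).

End AssociativityPolynomial.

(* Tangles are taken in the topological category, with round discs. Strings
   are subsets of the plane, so that gluing tangles amounts to taking unions.
   Arcs in the plane are tame: up to isotopy nothing changes with respect to
   smooth tangles. *)

Section Tangles.
Variable R : realType.

Definition plane := (R * R)%type.

(* A disc of rank k has 2k marked boundary points. [base] is a point of the
   distinguished boundary interval; [sign] is true when the region of the
   tangle next to it is unshaded. *)
Record disc := Disc {
  center : plane;
  radius : R;
  base : plane;
  pts : set plane;
  rank : nat;
  sign : bool }.

Definition color (D : disc) : nat * bool := (rank D, sign D).

Definition dist2 (a b : plane) : R := (a.1 - b.1) ^+ 2 + (a.2 - b.2) ^+ 2.

Definition closed_disc (D : disc) : set plane :=
  [set z | dist2 z (center D) <= radius D ^+ 2].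
Definition open_disc (D : disc) : set plane :=
  [set z | dist2 z (center D) < radius D ^+ 2].
Definition circle (D : disc) : set plane :=
  [set z | dist2 z (center D) = radius D ^+ 2].

Definition wf_disc (D : disc) : Prop :=
  [/\ 0 < radius D, circle D (base D), pts D `<=` circle D,
      ~ pts D (base D) & (pts D #= `I_((rank D).*2))%card].

Definition arc (A : set plane) (p q : plane) : Prop :=
  exists g : R -> plane,
    [/\ {within `[0, 1], continuous g}, set_inj `[0, 1] g,
        g 0 = p, g 1 = q & A = g @` `[0, 1]].

Definition loop (A : set plane) : Prop :=
  exists g : R -> plane,
    [/\ {within `[0, 1], continuous g}, set_inj `[0, 1[ g,
        g 0 = g 1 & A = g @` `[0, 1]].

(* The part of the open disc D0 that is outside of the inner discs. *)
Definition ambient (D0 : disc) (I : set disc) : set plane :=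
  open_disc D0 `\` \bigcup_(D in I) closed_disc D.

Definition marked (D0 : disc) (I : set disc) : set plane :=
  pts D0 `|` \bigcup_(D in I) pts D.

(* L is a union of finitely many disjoint loops and arcs, the arcs joining the
   marked points in pairs. *)
Definition is_strings (D0 : disc) (I : set disc) (L : set plane) : Prop :=
  exists C : set (set plane),
    [/\ finite_set C, trivIset C id, L = \bigcup_(A in C) A,
        marked D0 I `<=` L &
        forall A, C A ->
          loop A /\ A `<=` ambient D0 I \/
          exists p q, [/\ arc A p q, marked D0 I p, marked D0 I q &
                          A `\` [set p; q] `<=` ambient D0 I]].

(* The regions are the connected components of this set. *)
Definition regions (D0 : disc) (I : set disc) (L : set plane) : set plane :=
  ambient D0 I `\` L.

(* Sh is a union of regions, and any string has a region of Sh on one side and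
   a region outside of Sh on the other side. *)
Definition is_shading (D0 : disc) (I : set disc) (L Sh : set plane) : Prop :=
  [/\ Sh `<=` regions D0 I L, open Sh, open (regions D0 I L `\` Sh),
      forall z, L z -> ambient D0 I z ->
        closure Sh z /\ closure (regions D0 I L `\` Sh) z &
      forall D, D = D0 \/ I D -> sign D = false <-> closure Sh (base D)].

Definition is_tangle (D0 : disc) (I : set disc) (L Sh : set plane) : Prop :=
  [/\ wf_disc D0 /\ (forall D, I D -> wf_disc D),
      finite_set I /\ (forall D, I D -> closed_disc D `<=` open_disc D0),
      trivIset I closed_disc,
      is_strings D0 I L &
      is_shading D0 I L Sh].

Record tangle (D0 : disc) := Tangle {
  inner : set disc;
  strings : set plane;
  shaded : set plane;
  tangleP : is_tangle D0 inner strings shaded }.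

Definition carries_disc (h : plane -> plane) (D D' : disc) : Prop :=
  [/\ h @` closed_disc D = closed_disc D', h (base D) = base D',
      h @` pts D = pts D' & color D = color D'].

Definition carries (h : plane -> plane) (D0 D0' : disc)
    (T : tangle D0) (T' : tangle D0') : Prop :=
  [/\ carries_disc h D0 D0',
      forall D, inner T D -> exists2 D', inner T' D' & carries_disc h D D',
      forall D', inner T' D' -> exists2 D, inner T D & carries_disc h D D',
      h @` strings T = strings T' &
      h @` shaded T = shaded T'].

(* h is the end of an ambient isotopy of the plane. *)
Definition isotopic_to_id (h : plane -> plane) : Prop :=
  exists F G : R -> plane -> plane,
    [/\ continuous (fun u : R * plane => F u.1 u.2),
        continuous (fun u : R * plane => G u.1 u.2),
        forall t, cancel (F t) (G t) /\ cancel (G t) (F t),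
        F 0 = id & F 1 = h].

Definition flip (z : plane) : plane := (z.1, - z.2).

Definition mirror (D : disc) : disc :=
  Disc (flip (center D)) (radius D) (flip (base D)) (flip @` pts D)
       (rank D) (sign D).

(* U is obtained by inserting S in the inner disc D of T. *)
Definition is_gluing (D0 D : disc) (T : tangle D0) (S : tangle D)
    (U : tangle D0) : Prop :=
  [/\ inner T D,
      inner U = (inner T `\ D) `|` inner S,
      strings U = strings T `|` strings S,
      shaded U `&` regions D0 (inner T) (strings T) = shaded T &
      shaded U `&` regions D (inner S) (strings S) = shaded S].

(* p + t (q - p) *)
Definition along (p q : plane) (t : R) : plane :=
  (p.1 + t * (q.1 - p.1), p.2 + t * (q.2 - p.2)).

Definition segment (p q : plane) : set plane := along p q @` `[0, 1].

(* The tangle between two concentric discs, with radial strings and the base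
   points on the same radius. *)
Definition is_identity (D0 D : disc) (T : tangle D0) : Prop :=
  exists2 t : R, 1 < t &
    [/\ inner T = [set D],
        center D0 = center D /\ color D0 = color D,
        base D0 = along (center D) (base D) t,
        pts D0 = (fun p => along (center D) p t) @` pts D &
        strings T = \bigcup_(p in pts D) segment p (along (center D) p t)].

Definition labelling (P : nat * bool -> vectType R[i]) :=
  forall D : disc, P (color D).

(* For comparing elements of spaces whose colors are only provably equal. *)
Definition boxed (P : nat * bool -> vectType R[i]) (c : nat * bool) (v : P c)
  : {c : nat * bool & P c} := existT (fun c => P c : Type) c v.

(* A shaded planar *-algebra with finite-dimensional spaces; the space
   P_{k,+} is [pa_space (k, true)]. The action of a tangle takes a labelling
   of all discs of the plane, of which only the labels of the inner discs of
   the tangle matter. *)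
Record planar_algebra := PlanarAlgebra {
  pa_space :> nat * bool -> vectType R[i];
  pa_act : forall D0, tangle D0 -> labelling pa_space -> pa_space (color D0);
  pa_local : forall D0 (T : tangle D0) (f g : labelling pa_space),
    (forall D, inner T D -> f D = g D) -> pa_act T f = pa_act T g;
  pa_multilinear : forall D0 (T : tangle D0) (f g h : labelling pa_space)
      (D : disc) (a : R[i]),
    inner T D -> f D = a *: g D + h D ->
    (forall D', inner T D' -> D' <> D -> f D' = g D' /\ f D' = h D') ->
    pa_act T f = a *: pa_act T g + pa_act T h;
  pa_isotopy : forall (m : plane -> plane) D0 D0'
      (T : tangle D0) (T' : tangle D0') (f f' : labelling pa_space),
    isotopic_to_id m -> carries m T T' ->
    (forall D D', inner T D -> inner T' D' -> carries_disc m D D' ->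
       boxed (f D) = boxed (f' D')) ->
    boxed (pa_act T f) = boxed (pa_act T' f');
  pa_gluing : forall D0 D (T : tangle D0) (S : tangle D) (U : tangle D0)
      (f : labelling pa_space),
    is_gluing T S U -> f D = pa_act S f -> pa_act U f = pa_act T f;
  pa_identity : forall D0 D (T : tangle D0) (f : labelling pa_space),
    is_identity D T -> boxed (pa_act T f) = boxed (f D);
  pa_star : forall c, pa_space c -> pa_space c;
  pa_starK : forall c, involutive (@pa_star c);
  pa_starD : forall c (a : R[i]) (u v : pa_space c),
    pa_star (a *: u + v) = a^* *: pa_star u + pa_star v;
  pa_reflection : forall D0 D0' (T : tangle D0) (T' : tangle D0')
      (f f' : labelling pa_space),
    carries flip T T' ->
    (forall D D', inner T D -> inner T' D' -> carries_disc flip D D' ->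
       boxed (pa_star (f D)) = boxed (f' D')) ->
    boxed (pa_star (pa_act T f)) = boxed (pa_act T' f') }.

Variable P : planar_algebra.

(* The closed labelled tangle T is c times the empty tangle. *)
Definition has_value (D0 : disc) (T : tangle D0) (f : labelling P) (c : R[i])
  : Prop :=
  rank D0 = 0%N /\
  exists E : tangle D0,
    [/\ inner E = set0, strings E = set0 & pa_act T f = c *: pa_act E f].

(* The left and the right trace agree on the spaces P_{1,+} and P_{1,-}. *)
Definition spherical : Prop :=
  forall (D D0 D0' : disc) (T : tangle D0) (T' : tangle D0') (f : labelling P),
    rank D = 1%N -> inner T = [set D] -> inner T' = [set D] ->
    (exists p q, arc (strings T) p q) -> (exists p q, arc (strings T') p q) ->
    forall c, has_value T f c -> has_value T' f c.

(* <a, a> > 0 for a != 0, where <a, b> is obtained by joining a disc labelled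
   by a to its mirror image labelled by the adjoint of b. *)
Definition positive_definite : Prop :=
  forall (D D0 : disc) (T : tangle D0) (f : labelling P),
    radius D < (center D).2 -> rank D0 = 0%N ->
    inner T = [set D; mirror D] ->
    strings T = \bigcup_(p in pts D) segment p (flip p) ->
    f (mirror D) = pa_star (f D) -> f D != 0 ->
    exists2 c, 0 < c & has_value T f c.

Definition subfactor_planar_algebra : Prop :=
  [/\ forall s, \dim {: P (0%N, s)} = 1%N, spherical & positive_definite].

Definition irreducible_planar_algebra : Prop :=
  \dim {: P (1%N, true)} = 1%N.

(* The point of the disc drawn with center c and scale t that corresponds to
   the point (a, b) of the disc of radius 5 at the origin. *)
Definition place (c : plane) (t a b : R) : plane :=
  (c.1 + t * a, c.2 + t * b).

(* Strings end at the four points (-3, 4), (3, 4), (-3, -4), (3, -4) of the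
   circle of radius 5; the base point is on the left. *)
Definition box2 (c : plane) (t : R) : disc :=
  Disc c (5 * t) (place c t (-5) 0)
    [set z | exists a b : R,
       [/\ a = 3 \/ a = -3, b = 4 \/ b = -4 & z = place c t a b]] 2 true.

(* The same disc, with the base point on the right. *)
Definition box2_rot (c : plane) (t : R) : disc :=
  Disc c (5 * t) (place c t 5 0) (pts (box2 c t)) 2 true.

Definition box0 (s : bool) : disc :=
  Disc (0, 0) 20 (-20, 0) set0 0 s.

Definition outer2 : disc := box2 (0, 0) 4.
Definition top2 : disc := box2 (0, 8) 1.
Definition bottom2 : disc := box2 (0, -8) 1.
Definition left2 : disc := box2 (-8, 0) 1.
Definition right2 : disc := box2 (8, 0) 1.

(* The tangle with outer disc D0, inner discs I and strings L sends the
   labelling f to v. The shading is determined by these data. *)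
Definition evaluates (D0 : disc) (I : set disc) (L : set plane)
    (f : labelling P) (v : P (color D0)) : Prop :=
  exists T : tangle D0, [/\ inner T = I, strings T = L & pa_act T f = v].

(* u is on top, v at the bottom *)
Definition is_product (u v w : P (2%N, true)) : Prop :=
  exists f : labelling P,
    [/\ f top2 = u, f bottom2 = v &
      evaluates [set top2; bottom2]
        (\bigcup_(a in [set (1 : R); -1])
           (segment (a * 3, 12) (a * 12, 16) `|`
            segment (a * 3, 4) (a * 3, -4) `|`
            segment (a * 3, -12) (a * 12, -16)))
        f (w : P (color outer2))].

(* u is on the left, v on the right *)
Definition is_convolution (u v w : P (2%N, true)) : Prop :=
  exists f : labelling P,
    [/\ f left2 = u, f right2 = v &
      evaluates [set left2; right2]
        (\bigcup_(b in [set (1 : R); -1])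
           (segment (-12, b * 16) (-11, b * 4) `|`
            segment (-5, b * 4) (5, b * 4) `|`
            segment (11, b * 4) (12, b * 16)))
        f (w : P (color outer2))].

Definition is_rotation (u w : P (2%N, true)) : Prop :=
  exists f : labelling P,
    f (box2_rot (0, 0) 1) = u /\
    evaluates [set box2_rot (0, 0) 1]
      (\bigcup_(p in pts (box2 (0, 0) 1)) segment p (along (0, 0) p 4))
      f (w : P (color outer2)).

(* The unnormalized Markov trace of u is c: both right-hand and left-hand
   strings are closed on the right. *)
Definition is_trace (u : P (2%N, true)) (c : R[i]) : Prop :=
  exists (f : labelling P) (T : tangle (box0 true)),
    [/\ f (box2 (0, 0) 1) = u, inner T = [set box2 (0, 0) 1],
        strings T =
          (segment (3, 4) (8, 4) `|` segment (8, 4) (8, -4) `|`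
           segment (8, -4) (3, -4)) `|`
          (segment (-3, 4) (-3, 12) `|` segment (-3, 12) (12, 12) `|`
           segment (12, 12) (12, -12) `|` segment (12, -12) (-3, -12) `|`
           segment (-3, -12) (-3, -4)) &
        has_value T f c].

Definition circle_value (c : R[i]) : Prop :=
  forall s, exists (f : labelling P) (T : tangle (box0 s)),
    [/\ inner T = set0, strings T = [set z | dist2 z (0, 0) = 1] &
        has_value T f c].

Definition is_projection (u : P (2%N, true)) : Prop :=
  is_product u u u /\ pa_star u = u.

Definition minimal_projection (u : P (2%N, true)) : Prop :=
  [/\ is_projection u, u != 0 &
      forall v, is_projection v -> is_product u v v -> v = 0 \/ v = u].

End Tangles.

(* The irreducible subfactor planar algebra P realizes B: F identifies B with
   the 2-box space P_{2,+}. *)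
Definition realizes (R : realType) (n : nat) (B : fusion_bialgebra R n)
    (P : planar_algebra R) : Prop :=
  exists (F : {linear B -> P (2%N, true)}) (delta : R) (d : 'I_n.+1 -> R),
    [/\ bijective F,
        (forall u v w : P (2%N, true), is_product u v w -> is_product v u w) /\
        (forall u v, is_product (F u) (F v) (F (fb_dot u v))),
        (forall u v, is_convolution (F u) (F v) (F (u * v))) /\
        (forall j, is_rotation (F (tnth (fb_x B) j))
                               (F (tnth (fb_x B) (fb_inv B j)))),
        (forall q, minimal_projection q <-> exists j, q = F (tnth (fb_p B) j)) &
        [/\ circle_value P delta%:C,
            (forall j, is_trace (F (tnth (fb_p B) j)) (d j * delta)%:C) &
            forall j, tnth (fb_x B) j =
                      (Num.sqrt (delta / d j))%:C *: tnth (fb_p B) j]].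

Definition subfactorizable (R : realType) (n : nat) (B : fusion_bialgebra R n)
  : Prop :=
  exists P : planar_algebra R,
    [/\ subfactor_planar_algebra P, irreducible_planar_algebra P &
        realizes B P].

(* Main.v *)
Require Import Defs.
From mathcomp Require Import all_boot all_order all_algebra all_field.
From mathcomp Require Import -(notations) mpoly.
From mathcomp Require Import reals.
From mathcomp Require Import complex.
Import Order.TTheory GRing.Theory Num.Theory.

Set Implicit Arguments.
Unset Strict Implicit.
Unset Printing Implicit Defensive.

Local Open Scope ring_scope.

(** A polynomial with at least one monomial whose coefficients all have the
    same sign cannot vanish at a point with positive coordinates (mmap_gt0, up
    to sign). But f(i,j,k,l) vanishes at the fusion coefficients: its value
    there is the coefficient of p_l in (p_i p_j) p_k - p_i (p_j p_k), which is 0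
    by associativity (fusion_coef_assoc).

    The fusion coefficients are nonnegative (fusion_coef_ge0), but some of them
    may be 0. By the hypothesis on phi, the variables that stand for the
    vanishing ones are set to 0 in f, so that f has the same value at the point
    where these coordinates are replaced by 1 (mmap_assoc_poly). All coordinates
    of that point are positive, which gives the contradiction. *)

Section PositiveEvaluation.
Variables (R : numDomainType) (m : nat) (v : 'I_m -> R).
Hypothesis v_gt0 : forall i, 0 < v i.

Lemma mmap_gt0 (f : mpoly m int) :
  msupp f <> [::] -> (forall e, e \in msupp f -> 0 < mcoeff e f) ->
  0 < mmap intr v f.
Proof.
move=> /eqP f_neq0 f_gt0; rewrite /mmap big_seq.
have supp_f : has (mem (msupp f)) (msupp f).
  by case: (msupp f) f_neq0 => //= e s _; rewrite mem_head.
have sum0 : \sum_(e <- msupp f | e \in msupp f) 0 = 0 :> R by rewrite big1.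
(* comparing termwise with a sum of zeros gives a strict inequality only since
   the support is not empty *)
rewrite -[ltLHS]sum0.
apply: (ltr_sum supp_f) => e /f_gt0 fe_gt0.
rewrite mulr_gt0 ?ltr0z // prodr_gt0 // => i _; exact: exprn_gt0.
Qed.

End PositiveEvaluation.

Lemma basis_of_scale (K : fieldType) (V : vectType K) (U : {vspace V}) (m : nat)
    (X : m.-tuple V) (c : 'I_m -> K) :
  (forall i, c i != 0) -> basis_of U X ->
  basis_of U [tuple c i *: tnth X i | i < m].
Proof.
move=> c_neq0 X_basis; rewrite basisEfree; apply/and3P; split.
- apply/freeP => k sum0 i.
  have kc0 : k i * c i = 0.
    move/freeP: (basis_free X_basis) => /(_ (fun i => k i * c i)); apply.
    rewrite -[RHS]sum0; apply: eq_bigr => j _.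
    by rewrite -!tnth_nth tnth_mktuple scalerA.
  by move/eqP: kc0; rewrite mulf_eq0 (negPf (c_neq0 i)) orbF => /eqP.
- apply/span_subvP => _ /mapP[i _ ->].
  by rewrite memvZ // (basis_mem X_basis) // mem_tnth.
- by rewrite size_tuple (vector.size_basis X_basis).
Qed.

Section FusionCoefficients.
Variables (R : realType) (n : nat) (B : fusion_bialgebra R n).
Local Notation x := (fb_x B).
Local Notation p := (fb_p B).
Local Notation N := (@fusion_coef R n B).

Lemma fb_scaleC_gt0 k : 0 < (fb_scale B k)%:C%C.
Proof. by rewrite ltcR fb_scale_gt0. Qed.

Lemma fb_p_basis : basis_of fullv p.
Proof.
apply: basis_of_scale (fb_x_basis B) => k; exact: lt0r_neq0 (fb_scaleC_gt0 k).
Qed.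

Lemma coord_fb_x i u : coord x i u = coord p i u * (fb_scale B i)%:C%C.
Proof.
rewrite {1}(coord_basis fb_p_basis (memvf u)).
rewrite -[RHS](coord_sum_free (fun i => coord p i u * (fb_scale B i)%:C%C) i
  (basis_free (fb_x_basis B))).
congr (coord _ _ _); apply: eq_bigr => j _.
by rewrite -!tnth_nth tnth_mktuple scalerA.
Qed.

(** The basis p rescales the basis x by positive factors, so it inherits the
    sign of the structure constants. *)
Lemma fusion_coef_ge0 k j i : 0 <= N k j i.
Proof.
rewrite /fusion_coef !tnth_mktuple -scalerAl -scalerAr !linearZ /=.
rewrite mulr_ge0 ?(ltW (fb_scaleC_gt0 _)) //.
rewrite mulr_ge0 ?(ltW (fb_scaleC_gt0 _)) //.
by rewrite -(pmulr_lge0 _ (fb_scaleC_gt0 i)) -coord_fb_x fb_x_ge0.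
Qed.

Lemma fusion_coefP k j :
  tnth p k * tnth p j = \sum_(i < n.+1) N k j i *: tnth p i.
Proof.
rewrite [LHS](coord_basis fb_p_basis (memvf _)).
by apply: eq_bigr => i _; rewrite -tnth_nth.
Qed.

(** Both sides are the coordinate on p_l of p_i p_j p_k, bracketed from the
    left and from the right. *)
Lemma fusion_coef_assoc i j k l :
  \sum_(s < n.+1) N i j s * N s k l = \sum_(s < n.+1) N i s l * N j k s.
Proof.
transitivity (coord p l (tnth p i * tnth p j * tnth p k)).
  rewrite fusion_coefP mulr_suml linear_sum.
  by apply: eq_bigr => s _; rewrite -scalerAl linearZ.
rewrite -mulrA (fusion_coefP j k) mulr_sumr linear_sum.
by apply: eq_bigr => s _; rewrite -scalerAr linearZ mulrC.
Qed.

(** Giving the value 1 to the variables of the vanishing fusion coefficients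
    makes all coordinates positive, and does not change the value of
    polynomials in the variables of the other ones. *)
Definition fusion_point (t : 'I_#|{: 'I_n.+1 * 'I_n.+1 * 'I_n.+1}|) : R[i] :=
  let: (k, j, i) := enum_val t in if N k j i == 0 then 1 else N k j i.

Lemma fusion_point_gt0 t : 0 < fusion_point t.
Proof.
rewrite /fusion_point; case: (enum_val t) => -[k j] i.
by case: eqP => // /eqP N_neq0; rewrite lt0r N_neq0 fusion_coef_ge0.
Qed.

Variable phi : 'I_n.+1 -> 'I_n.+1 -> 'I_n.+1 -> bool.
Hypothesis phiE : forall i j k, phi i j k = indicator B i j k.

Lemma mmap_coef_var k j i :
  mmap intr fusion_point (coef_var phi k j i) = N k j i.
Proof.
rewrite /coef_var phiE /indicator; case: ifPn => [N_neq0 | /negPn/eqP ->].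
  by rewrite mmapX mmap1U /fusion_point enum_rankK (negPf N_neq0).
exact: mmap0.
Qed.

Lemma mmap_assoc_poly i j k l :
  mmap intr fusion_point (assoc_poly phi i j k l) = 0.
Proof.
rewrite /assoc_poly rmorphB /= !rmorph_sum /=.
under eq_bigr do rewrite rmorphM /= !mmap_coef_var.
under [X in _ - X]eq_bigr do rewrite rmorphM /= !mmap_coef_var.
by rewrite fusion_coef_assoc subrr.
Qed.

End FusionCoefficients.

Theorem proposition5p7 (R : realType) (n : nat) (B : fusion_bialgebra R n)
    (phi : 'I_n.+1 -> 'I_n.+1 -> 'I_n.+1 -> bool) :
  (forall i j k : 'I_n.+1, phi i j k = indicator B i j k) ->
  (exists i j k l : 'I_n.+1,
     msupp (assoc_poly phi i j k l) <> [::] /\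
     one_signed (assoc_poly phi i j k l)) ->
  ~ subfactorizable B.
Proof.
move=> phiE [i [j [k [l [f_neq0 f_signed]]]]] _.
have f0 := mmap_assoc_poly phiE i j k l.
case: f_signed => [f_gt0 | f_lt0].
  have := mmap_gt0 (fusion_point_gt0 B) f_neq0 f_gt0.
  by rewrite f0 ltxx.
have: 0 < mmap intr (fusion_point B) (- assoc_poly phi i j k l).
  apply: (mmap_gt0 (fusion_point_gt0 B)).
    move/eqP: f_neq0; rewrite msupp_eq0 => f_neq0.
    by apply/eqP; rewrite msupp_eq0 oppr_eq0.
  move=> e; rewrite mcoeffN oppr_gt0 (perm_mem (msuppN _)); exact: f_lt0.
by rewrite rmorphN /= f0 oppr0 ltxx.
Qed.
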